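(* For each of the four balancing schemes (AVL trees, red-black trees, weight-balanced trees, treaps), the work of $\mathrm{join2}(T_l,T_r)$ (the generic algorithm in the context, using the scheme's join) is $O(r(T_l)+r(T_r))$ (with high probability for treaps).
   Context: A binary tree is either $\mathrm{Leaf}$ or $\mathrm{Node}(L,k,R)$; $\mathrm{expose}(\mathrm{Node}(L,k,R))=(L,k,R)$; size $|T|$, weight $w(T)=|T|+1$, height $h(T)$. Balancing schemes and ranks: AVL (children heights differ by at most one at every node; $r(T)=h(T)-1$); red-black (nodes red/black, leaves black, no red node has a red child, all downward paths to leaves have equal numbers of black nodes, root may be red; with $\mathrm{bh}(T)$ the number of black nodes on a downward root-to-leaf path including the root, $r(T)=2(\mathrm{bh}(T)-1)$ if the root is black and $2\mathrm{bh}(T)-1$ if red); $\alpha$ weight-balanced with $\frac{2}{11}<\alpha\le1-\frac1{\sqrt2}$ (every $T=\mathrm{Node}(L,v,R)$ has $\alpha\le w(L)/w(T)\le 1-\alpha$; $r(T)=\lceil\log_2w(T)\rceil-1$); treaps (independent uniformly random priorities, heap-ordered with highest priority at the root; $r(T)=\lceil\log_2w(T)\rceil-1$). For each scheme, $\mathrm{join}(T_l,k,T_r)$ is the scheme-specific algorithm returning a balanced tree with in-order sequence $T_l,k,T_r$; it satisfies: for AVL, RB, WB trees it costs $O(|r(T_l)-r(T_r)|)$ work, for treaps $O(\log t)$ expected work when $k$ has the $t$-th highest priority, and the result $T$ has $\max(r(T_l),r(T_r))\le r(T)\le1+\max(r(T_l),r(T_r))$. $\mathrm{splitLast}(T)$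 for nonempty $T$: let $(L,k,R)=\mathrm{expose}(T)$; if $R=\mathrm{Leaf}$ return $(L,k)$; else let $(T',k')=\mathrm{splitLast}(R)$ and return $(\mathrm{join}(L,k,T'),k')$. $\mathrm{join2}(T_l,T_r)$: if $T_l=\mathrm{Leaf}$ return $T_r$; else let $(T_l',k)=\mathrm{splitLast}(T_l)$ and return $\mathrm{join}(T_l',k,T_r)$. Work counts all operations; expose and node creation cost $O(1)$. ''With high probability'' means probability at least $1-N^{-c}$ for any constant $c>0$. *)

(* Defs.v *)
From HB Require Import structures.
From mathcomp Require Import all_boot all_order all_algebra.
From mathcomp Require Import all_classical all_reals all_analysis.

Set Implicit Arguments.
Unset Strict Implicit.
Unset Printing Implicit Defensive.

Import Order.TTheory GRing.Theory Num.Theory.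
Import numFieldNormedType.Exports.
Local Open Scope ring_scope.

(* A node carries a key of type [K] and balancing data of type [M]: a colour
   for red-black trees, nothing ([unit]) for the other schemes. *)
Inductive tree (M K : Type) : Type :=
| Leaf : tree M K
| Node : M -> tree M K -> K -> tree M K -> tree M K.
Arguments Leaf {M K}.
Arguments Node {M K}.

(* A computed value together with the work spent on computing it. *)
Definition costed (A : Type) : Type := (A * nat)%type.
Definition value (A : Type) (x : costed A) : A := x.1.
Definition work (A : Type) (x : costed A) : nat := x.2.
Definition ret (A : Type) (a : A) : costed A := (a, 0%N).
Definition bind (A B : Type) (x : costed A) (f : A -> costed B) : costed B :=
  (value (f (value x)), (work x + work (f (value x)))%N).
Definition tick (A : Type) (x : costed A) : costed A := (value x, (work x).+1).

Section Trees.
Variables M K : Type.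
Implicit Types T L R : tree M K.

Fixpoint size_tree T : nat :=
  if T is Node _ L _ R then (size_tree L + size_tree R).+1 else 0%N.

Definition weight T : nat := (size_tree T).+1.

Fixpoint height T : nat :=
  if T is Node _ L _ R then (maxn (height L) (height R)).+1 else 0%N.

Fixpoint inorder T : seq K :=
  if T is Node _ L k R then inorder L ++ k :: inorder R else [::].

(* [up_log 2 w] is the ceiling of the base-2 logarithm of [w] for [w > 0].
   In particular the rank of a leaf is -1. *)
Definition rank_weight T : int := (up_log 2 (weight T))%:Z - 1.

Variable join : tree M K -> K -> tree M K -> costed (tree M K).

(* [splitLast L k R] is splitLast applied to a nonempty tree exposed as
   (L, k, R). One unit of work per call accounts for the constant-time
   operations (test, expose, return); calls to [join] add their own work. *)
Fixpoint splitLast L (k : K) R {struct R} : costed (tree M K * K) :=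
  tick (match R with
        | Leaf => ret (L, k)
        | Node _ L1 k1 R1 =>
            bind (splitLast L1 k1 R1) (fun s =>
            bind (join L k s.1) (fun T => ret (T, s.2)))
        end).

Definition join2 (Tl Tr : tree M K) : costed (tree M K) :=
  tick (match Tl with
        | Leaf => ret Tr
        | Node _ L k R =>
            bind (splitLast L k R) (fun s => join s.1 s.2 Tr)
        end).

End Trees.

(* Here and in the other work bounds, a bound O(g) is read as [C * max(1, g)] for some
   constant [C], since ranks and rank differences may be 0 and the rank of a
   leaf may be -1. *)
Record join_spec (M K : Type) (balanced : tree M K -> bool)
    (rank : tree M K -> int)
    (join : tree M K -> K -> tree M K -> costed (tree M K)) : Prop := JoinSpec {
  join_balanced : forall Tl k Tr, balanced Tl -> balanced Tr ->
    balanced (value (join Tl k Tr));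
  join_inorder : forall Tl k Tr, balanced Tl -> balanced Tr ->
    inorder (value (join Tl k Tr)) = inorder Tl ++ k :: inorder Tr;
  join_rank : forall Tl k Tr, balanced Tl -> balanced Tr ->
    Num.max (rank Tl) (rank Tr) <= rank (value (join Tl k Tr))
      <= 1 + Num.max (rank Tl) (rank Tr);
  join_work : exists C : nat, forall Tl k Tr, balanced Tl -> balanced Tr ->
    (work (join Tl k Tr))%:Z <= C%:Z * Num.max 1 `|rank Tl - rank Tr|
}.

Definition join2_work_bound (M K : Type) (balanced : tree M K -> bool)
    (rank : tree M K -> int)
    (join : tree M K -> K -> tree M K -> costed (tree M K)) : Prop :=
  exists C : nat, forall Tl Tr, balanced Tl -> balanced Tr ->
    (work (join2 join Tl Tr))%:Z <= C%:Z * Num.max 1 (rank Tl + rank Tr).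

Section AVL.
Variable K : Type.

Fixpoint avl (T : tree unit K) : bool :=
  if T is Node _ L _ R then
    [&& (height L <= (height R).+1)%N, (height R <= (height L).+1)%N,
        avl L & avl R]
  else true.

Definition rank_avl (T : tree unit K) : int := (height T)%:Z - 1.

End AVL.

Inductive color : Type := Red | Black.
Definition is_black (c : color) : bool := if c is Black then true else false.

Section RedBlack.
Variable K : Type.
Implicit Types T : tree color K.

Definition root_color T : color := if T is Node c _ _ _ then c else Black.

Fixpoint no_red_red T : bool :=
  if T is Node c L _ R then
    [&& is_black c || (is_black (root_color L) && is_black (root_color R)),
        no_red_red L & no_red_red R]
  else true.

(* The numbers of black nodes on all the downward paths from the root to the
   leaves, both ends included (a leaf counts as a black node). *)
Fixpoint path_blacks T : seq nat :=
  if T is Node c L _ R then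
    [seq (is_black c + b)%N | b <- path_blacks L ++ path_blacks R]
  else [:: 1%N].

Definition red_black T : bool := no_red_red T && constant (path_blacks T).

Definition black_height T : nat := head 0%N (path_blacks T).

Definition rank_rb T : int :=
  if root_color T is Black then 2 * ((black_height T)%:Z - 1)
  else 2 * (black_height T)%:Z - 1.

End RedBlack.

Section WeightBalanced.
Variables (R : realType) (K : Type) (alpha : R).

Fixpoint weight_balanced (T : tree unit K) : bool :=
  if T is Node _ L _ R0 then
    [&& alpha <= (weight L)%:R / (weight T)%:R <= 1 - alpha,
        weight_balanced L & weight_balanced R0]
  else true.

End WeightBalanced.

Section Treap.
Variables (R : realType) (K : Type).

(* An entry of a treap is a key paired with its priority. *)
Local Notation entry := (K * R)%type.
Implicit Types T : tree unit entry.

Fixpoint treap T : bool :=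
  if T is Node _ L e R0 then
    [&& all (fun e' : entry => e'.2 <= e.2) (inorder L ++ inorder R0),
        treap L & treap R0]
  else true.

Definition outranks (e : entry) T : bool :=
  if T is Node _ _ e' _ then e'.2 <= e.2 else true.

(* If the new entry has the highest priority it becomes the root; otherwise
   the root of higher priority is kept and the join proceeds into its inner
   subtree. One unit of work per call. *)
Fixpoint join_treap (Tl : tree unit entry) (e : entry) {struct Tl} :
    tree unit entry -> costed (tree unit entry) :=
  fix join_r (Tr : tree unit entry) : costed (tree unit entry) :=
    tick (if outranks e Tl && outranks e Tr then ret (Node tt Tl e Tr) else
      match Tl, Tr with
      | Leaf, Leaf => ret (Node tt Tl e Tr)
      | Node _ L1 e1 R1, Leaf =>
          bind (join_treap R1 e Tr) (fun T => ret (Node tt L1 e1 T))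
      | Leaf, Node _ L2 e2 R2 =>
          bind (join_r L2) (fun T => ret (Node tt T e2 R2))
      | Node _ L1 e1 R1, Node _ L2 e2 R2 =>
          if e2.2 < e1.2 then
            bind (join_treap R1 e Tr) (fun T => ret (Node tt L1 e1 T))
          else
            bind (join_r L2) (fun T => ret (Node tt T e2 R2))
      end).

End Treap.

Section Probability.
Local Open Scope classical_set_scope.
Context (d : measure_display) (Omega : measurableType d) (R : realType).
Variable P : probability Omega R.

Definition independent_RVs (I : finType) (X : I -> {RV P >-> R}) : Prop :=
  forall (J : {set I}) (A : I -> set R), (forall i, measurable (A i)) ->
    P (\bigcap_(i in [set` J]) (X i @^-1` A i))
      = (\prod_(i in J) P (X i @^-1` A i))%E.

Definition uniform01 (X : {RV P >-> R}) : Prop :=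
  forall A : set R, measurable A ->
    distribution P X A = uniform_prob (@ltr01 R) A.

(* [A] holds with probability at least [1 - N ^ -c]; phrased with a measurable
   event included in [A], so that [A] need not be shown measurable. *)
Definition with_prob_at_least (N : nat) (c : R) (A : set Omega) : Prop :=
  exists E : set Omega, [/\ measurable E, E `<=` A &
    ((1 - N%:R `^ (- c))%:E <= P E)%E].

End Probability.

(* Main.v *)
Require Import Defs.
From HB Require Import structures.
From mathcomp Require Import all_boot all_order all_algebra.
From mathcomp Require Import all_classical all_reals all_analysis.
From mathcomp Require Import zify ring lra.
Set Implicit Arguments.
Unset Strict Implicit.
Unset Printing Implicit Defensive.
Import Order.TTheory GRing.Theory Num.Theory.
Local Open Scope ring_scope.

(** Deterministic schemes: deleting the last entry changes the rank of a tree by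
    a bounded amount, and so does passing to a child, hence every join performed
    by splitLast has arguments of nearly equal ranks and costs O(1).  The right
    spine has length O(rank), so only the final join can cost more, at most the
    difference of the ranks.  For weight-balanced trees the rank of the result of
    splitLast is controlled through its size, since a child may have the same
    rank as its parent.

    Treaps: every join performed by splitLast puts its key at the root at once,
    and the final join walks down two spines.  The entries of a spine are records
    of the sequence of priorities.  Cutting [0,1[ into Q cells turns n priorities
    into a uniform word over Q letters with at least as many records; if G n x is
    the sum of 2^(number of records) over the words of length n over x letters,
    then G (n+1) x = x G n x + sum_(v < x) G n (v+1), whence
    G n x <= (n+1) (x+n)^n.  For Q >= 2 n^2 Markov's inequality bounds the
    probability of k records by 2 (n+1) / 2^k. *)

(** * Spines and in-order size *)

Fixpoint right_spine (M K : Type) (T : tree M K) : nat :=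
  if T is Node _ _ _ R then (right_spine R).+1 else 0%N.

Fixpoint left_spine (M K : Type) (T : tree M K) : nat :=
  if T is Node _ L _ _ then (left_spine L).+1 else 0%N.

Lemma size_inorder (M K : Type) (T : tree M K) : size (inorder T) = size_tree T.
Proof.
elim: T => //= m L IHL k R IHR.
by rewrite size_cat /= IHL IHR addnS.
Qed.

(** * Work of [join2] for an abstract deterministic scheme *)

Section GenericJoin2.
Variables (M K : Type) (balanced : tree M K -> bool) (rank : tree M K -> int).
Variable join : tree M K -> K -> tree M K -> costed (tree M K).
Hypothesis spec : join_spec balanced rank join.
Variables D A : nat.
Hypothesis rank_ge : forall T, balanced T -> -1 <= rank T.
Hypothesis balanced_children : forall m L k R, balanced (Node m L k R) ->
  balanced L && balanced R.
Hypothesis rank_children : forall m L k R, balanced (Node m L k R) ->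
  (rank (Node m L k R) - D%:Z <= rank L <= rank (Node m L k R)) &&
  (rank (Node m L k R) - D%:Z <= rank R <= rank (Node m L k R)).
(** This forbids rank growth when a subtree has lost its last entry. AVL and red-black trees obtain
    it from the premise on ranks, weight-balanced trees from the premise on sizes. *)
Hypothesis rank_join_le : forall m L k R S,
  balanced (Node m L k R) -> balanced S -> (size_tree S).+1 = size_tree R ->
  rank S <= rank R -> rank (value (join L k S)) <= rank (Node m L k R).
Hypothesis right_spine_le : forall T, balanced T ->
  (right_spine T)%:Z <= A%:Z * (rank T + 1).

(** The rank bounds do not degrade along the spine: the upper one is [rank_join_le], and the lower
    one holds because the joined tree has rank at least [rank L], which is already within [D] of
    [rank T]. *)
Lemma splitLast_spec (C : nat) :
  (forall Tl k Tr, balanced Tl -> balanced Tr ->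
     (work (join Tl k Tr))%:Z <= C%:Z * Num.max 1 `|rank Tl - rank Tr|) ->
  forall R m L k, let T := Node m L k R in let S := splitLast join L k R in
  balanced T ->
  [/\ balanced (value S).1, (size_tree (value S).1).+1 = size_tree T,
      rank T - D%:Z <= rank (value S).1 <= rank T &
      (work S <= (C * (2 * D).+1).+1 * right_spine T)%N].
Proof.
move=> joinC; elim=> [|m1 L1 _ k1 R1 IH] m L k T S balT.
  have /andP[balL _] := balanced_children balT.
  have /andP[rL _] := rank_children balT.
  by split=> //=; rewrite /T /= ?addn0 //; lia.
have /andP[balL balR] := balanced_children balT.
have /andP[rL rR] := rank_children balT.
have [balS sizeS rS workS] := IH _ _ _ balR.
rewrite {}/S /=; set S := splitLast join L1 k1 R1 in balS sizeS rS workS *.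
have rJ := join_rank spec k balL balS.
split.
- exact: (join_balanced spec).
- have := size_inorder (value (join L k (value S).1)).
  rewrite (join_inorder spec) // size_cat /= !size_inorder => <-.
  by move: sizeS => /=; lia.
- have := rank_join_le balT balS sizeS (proj2 (andP rS)); rewrite -/T.
  by move: rJ rL; rewrite -/T; lia.
- have jw := joinC L k (value S).1 balL balS.
  (* Both children lie within [D] below [rank T], and [splitLast] lowers the right one by at most
     another [D]. *)
  have dist : Num.max 1 `|rank L - rank (value S).1| <= (2 * D).+1%:Z.
    by move: rL rR rS; rewrite -/T; lia.
  have : (work (join L k (value S).1) <= C * (2 * D).+1)%N.
    by rewrite -lez_nat PoszM; apply: le_trans jw _; apply: ler_wpM2l.
  rewrite {1}/work /= addn0 -/(work S) -/(work (join L k (value S).1)) => jw'.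
  by rewrite mulnS; move: workS => /=; lia.
Qed.

Lemma join2_work_boundP : join2_work_bound balanced rank join.
Proof.
have [C joinC] := join_work spec.
(* The summands pay for [splitLast], for the final join and for the [tick] of [join2]. The factors 3
   absorb ranks equal to -1: [rank T + 1 <= X + 2 <= 3 * X]. *)
exists ((C * (2 * D).+1).+1 * A * 3 + C * 3 + 1)%N => -[|m L k R] Tr balTl balTr.
  apply: le_trans (_ : 1 * Num.max 1 (rank Leaf + rank Tr) <= _).
    by rewrite /work /=; lia.
  by apply: ler_wpM2r; lia.
have [balS _ rS workS] := splitLast_spec joinC balTl.
set T := Node m L k R in balTl rS workS *.
set S := splitLast join L k R in balS rS workS *.
have rT := rank_ge balTl; have rTr := rank_ge balTr; have rSm := rank_ge balS.
have jw := joinC _ (value S).2 _ balS balTr.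
have sp := right_spine_le balTl.
set X : int := Num.max 1 (rank T + rank Tr).
have X1 : 1 <= X by rewrite /X; lia.
have dist : Num.max 1 `|rank (value S).1 - rank Tr| <= 3 * X.
  by rewrite /X; lia.
have rTX : rank T + 1 <= 3 * X by rewrite /X; lia.
have jw' : (work (join (value S).1 (value S).2 Tr))%:Z <= C%:Z * (3 * X).
  by apply: le_trans jw _; apply: ler_wpM2l.
have sp' : (right_spine T)%:Z <= A%:Z * (3 * X).
  by apply: le_trans sp _; apply: ler_wpM2l.
have ws : (work S)%:Z <= (C * (2 * D).+1).+1%:Z * (A%:Z * (3 * X)).
  apply: le_trans (_ : ((C * (2 * D).+1).+1 * right_spine T)%N%:Z <= _).
    by rewrite lez_nat.
  by rewrite PoszM; apply: ler_wpM2l.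
have -> : work (join2 join T Tr) =
  (work S + work (join (value S).1 (value S).2 Tr)).+1 by [].
rewrite !PoszD !PoszM.
move: jw' ws; set a := (work S); set b := work (join _ _ _).
set e := Posz (C * _).+1 => h1 h2.
rewrite (_ : (a + b).+1%:Z = a%:Z + b%:Z + 1); last by lia.
rewrite !mulrDl.
rewrite (_ : e * A%:Z * 3 * X = e * (A%:Z * (3 * X))); last by ring.
rewrite (_ : C%:Z * 3 * X = C%:Z * (3 * X)); last by ring.
by lia.
Qed.

End GenericJoin2.

(** * AVL trees *)

Lemma avl_join2_work (K : Type) join :
  join_spec (@avl K) (@rank_avl K) join ->
  join2_work_bound (@avl K) (@rank_avl K) join.
Proof.
move=> spec; apply: (join2_work_boundP spec (D := 2) (A := 1)).
- by move=> T _; rewrite /rank_avl; lia.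
- by move=> m L k R /= /and4P[_ _ -> ->].
- by move=> m L k R /= /and4P[h1 h2 _ _]; rewrite /rank_avl /=; lia.
- move=> m L k R S balT balS _ rS.
  have /= /and4P[_ _ balL balR] := balT.
  have := join_rank spec k balL balS.
  by move: rS; rewrite /rank_avl /=; lia.
- move=> T _; rewrite /rank_avl mul1r subrK lez_nat.
  by elim: T => //= m L _ k R IH; lia.
Qed.

(** * Red-black trees *)

(** There is always a path, so the default value of [head] in [black_height] never occurs. *)
Lemma path_blacks_head (K : Type) (T : tree color K) :
  path_blacks T = black_height T :: behead (path_blacks T).
Proof.
rewrite /black_height; elim: T => //= c L -> k R IH //=.
Qed.

Lemma black_height_gt0 (K : Type) (T : tree color K) : (0 < black_height T)%N.
Proof.
elim: T => //= c L IH k R _.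
by rewrite /black_height /= path_blacks_head /= addn_gt0 IH orbT.
Qed.

Lemma black_height_node (K : Type) c (L : tree color K) k R :
  black_height (Node c L k R) = (is_black c + black_height L)%N.
Proof. by rewrite /black_height /= path_blacks_head. Qed.

Lemma constant_map_addn (b : nat) s : constant [seq (b + x)%N | x <- s] = constant s.
Proof.
case: s => //= x s; rewrite all_map; apply: eq_all => y /=.
by rewrite eqn_add2l.
Qed.

Lemma red_black_node (K : Type) c (L : tree color K) k R :
  red_black (Node c L k R) ->
  [/\ red_black L, red_black R, black_height L = black_height R &
      ~~ is_black c -> is_black (root_color L) && is_black (root_color R)].
Proof.
rewrite /red_black /= => /andP[/and3P[cLR nL nR]].
rewrite constant_map_addn (path_blacks_head L) (path_blacks_head R) /=.
rewrite all_cat /= => /and3P[cL /eqP eLR cR].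
rewrite nL nR /=; split=> //.
- by rewrite eLR.
- by move: cLR; case: (is_black c).
Qed.

(** A black child of a black node loses two, any other child loses one. The strict drop bounds the
    right spine by the rank and absorbs the [1 +] of [join_rank]. *)
Lemma rank_rb_children (K : Type) c (L : tree color K) k R :
  let T := Node c L k R in red_black T ->
  (rank_rb T - 2 <= rank_rb L <= rank_rb T - 1) &&
  (rank_rb T - 2 <= rank_rb R <= rank_rb T - 1).
Proof.
move=> T balT; have [_ _ eLR cLR] := red_black_node balT.
rewrite /rank_rb {balT}/T black_height_node -eLR /=; move: cLR.
by case: c; case: (root_color L); case: (root_color R) => //= h; try lia;
  have := h isT.
Qed.

Lemma rank_rb_ge0 (K : Type) (T : tree color K) : 0 <= rank_rb T.
Proof.
by have := black_height_gt0 T; rewrite /rank_rb; case: root_color; lia.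
Qed.

Lemma rb_join2_work (K : Type) join :
  join_spec (@red_black K) (@rank_rb K) join ->
  join2_work_bound (@red_black K) (@rank_rb K) join.
Proof.
move=> spec; apply: (join2_work_boundP spec (D := 2) (A := 1)).
- by move=> T _; have := rank_rb_ge0 T; lia.
- by move=> m L k R balT; have [-> ->] := red_black_node balT.
- by move=> m L k R balT; have := rank_rb_children balT; lia.
- move=> m L k R S balT balS _ rS.
  have [balL balR _ _] := red_black_node balT.
  have := join_rank spec k balL balS.
  by have := rank_rb_children balT; lia.
- move=> T; rewrite mul1r.
  elim: T => [|m L _ k R IH] balT; first by have := rank_rb_ge0 (@Leaf color K).
  have [_ balR _ _] := red_black_node balT.
  by have := IH balR; have := rank_rb_children balT => /=; lia.
Qed.

(** * Weight-balanced trees *)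

Lemma weight_node (M K : Type) m (L : tree M K) k R :
  weight (Node m L k R) = (weight L + weight R)%N.
Proof. by rewrite /weight /= addSn addnS. Qed.

(** Since 2 * 9^4 = 13122 <= 14641 = 11^4, the fourth power of the weight at least doubles at each
    step up a spine. *)
Lemma leq_mul2_exp4 (a b c : nat) :
  (c <= a ^ 4 -> 11 * a <= 9 * b -> 2 * c <= b ^ 4)%N.
Proof.
move=> ca ab; have : ((11 * a) ^ 4 <= (9 * b) ^ 4)%N by rewrite leq_exp2r.
by rewrite !expnMn; move: (a ^ 4)%N (b ^ 4)%N ca => x y cx; lia.
Qed.

Section WeightBalanced.
Variables (R : realType) (K : Type) (alpha : R).
Hypothesis alpha_gt : 2 / 11 < alpha.

Lemma weight_balanced_node m (L : tree unit K) k T :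
  weight_balanced alpha (Node m L k T) ->
  [&& weight_balanced alpha L, weight_balanced alpha T,
      (11 * weight L <= 9 * weight (Node m L k T))%N &
      (11 * weight T <= 9 * weight (Node m L k T))%N].
Proof.
move=> /= /and3P[/andP[h1 h2] -> ->] /=.
change (size_tree _ + size_tree _).+2 with (weight (Node m L k T)) in h1, h2 |- *.
set w := weight (Node _ _ _ _) in h1 h2 |- *.
have eqw : w = (weight L + weight T)%N by exact: weight_node.
have w0 : 0 < w%:R :> R by rewrite ltr0n.
move: h1 h2; rewrite ler_pdivlMr // ler_pdivrMr // => h1 h2.
rewrite -!(ler_nat R) !natrM.
have := congr1 (fun n => n%:R : R) eqw; rewrite natrD => eqw'.
have : 2 / 11 * w%:R <= alpha * w%:R by rewrite ler_pM2r // ltW.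
move: h1 h2; rewrite mulrBl mul1r.
by move: (alpha * _) => x h1 h2 h3; apply/andP; split; lra.
Qed.

Lemma wb_join2_work join :
  join_spec (@weight_balanced R K alpha) (@rank_weight unit K) join ->
  join2_work_bound (@weight_balanced R K alpha) (@rank_weight unit K) join.
Proof.
(* A child has at least 2/11 > 1/8 of the weight, so its rank drops by at most 3. The value 4 is the
   exponent in [leq_mul2_exp4]. *)
move=> spec; apply: (join2_work_boundP spec (D := 3) (A := 4)).
- by move=> T _; rewrite /rank_weight; lia.
- by move=> m L k T /weight_balanced_node /and4P[-> ->].
- move=> m L k T /weight_balanced_node /and4P[_ _ hL hT].
  have eqw := weight_node m L k T.
  set w := weight (Node _ _ _ _) in hL hT eqw.
  rewrite /rank_weight -/w.
  have up (a : nat) : (0 < a -> a <= w -> w <= 2 ^ 3 * a ->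
     up_log 2 a <= up_log 2 w <= 3 + up_log 2 a)%N.
    move=> a0 aw wa; rewrite leq_up_log //=.
    apply: up_log_min => //; rewrite expnD.
    apply: leq_trans wa _; rewrite leq_mul2l /=.
    exact: up_logP.
  have h1 := up (weight L) isT ltac:(lia) ltac:(lia).
  have h2 := up (weight T) isT ltac:(lia) ltac:(lia).
  by lia.
- move=> m L k T S balT balS sizeS _.
  have /and4P[balL _ _ _] := weight_balanced_node balT.
  rewrite /rank_weight lerD2r lez_nat; apply: leq_up_log.
  rewrite /weight -size_inorder (join_inorder spec) // size_cat /= !size_inorder.
  by lia.
- move=> T balT; rewrite /rank_weight subrK -PoszM lez_nat.
  suff : (2 ^ right_spine T <= weight T ^ 4)%N.
    move=> h; rewrite -(@leq_exp2l 2) //; apply: leq_trans h _.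
    rewrite mulnC expnM leq_exp2r //; exact: up_logP.
  elim: T balT => // m L _ k T IH balT.
  have /and4P[_ bT _ hT] := weight_balanced_node balT.
  by rewrite [right_spine _]/= expnS; apply: leq_mul2_exp4 (IH bT) hT.
Qed.

End WeightBalanced.

(** * Treap work bounded by records of the priorities *)

(* Records are weak: ties count, so that every treap (not unique when priorities
   tie) is covered and discretizing priorities can only add records. *)
Fixpoint suffix_records (T : Type) (le : rel T) (s : seq T) : nat :=
  if s is x :: s' then (all (le^~ x) s' + suffix_records le s')%N else 0%N.

Lemma suffix_records_cat (T : Type) (le : rel T) s1 s2 :
  (suffix_records le s2 <= suffix_records le (s1 ++ s2))%N.
Proof. by elim: s1 => //= x s1 IH; apply: leq_trans IH (leq_addl _ _). Qed.

Lemma suffix_records_le (I : eqType) (T U : Type) (f : I -> T) (g : I -> U)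
    (leT : rel T) (leU : rel U) (s : seq I) :
  {in s &, forall i j, leT (f i) (f j) -> leU (g i) (g j)} ->
  (suffix_records leT (map f s) <= suffix_records leU (map g s))%N.
Proof.
elim: s => //= i s IH fg; apply: leq_add; last first.
  by apply: IH => j l js ls; apply: fg; rewrite inE ?js ?ls orbT.
rewrite !all_map; case: (boolP (all _ s)) => //= /allP h.
rewrite (_ : all _ _) //; apply/allP => j js /=.
by apply: fg (h j js); rewrite inE ?js ?eqxx ?orbT.
Qed.

Section TreapWork.
Variables (R : realType) (K : Type).
Local Notation entry := (K * R)%type.
Implicit Types T L : tree unit entry.

Definition priorities T : seq R := map snd (inorder T).

(** The entries after a right-spine node in in-order are exactly its right subtree, which heap order
    keeps below it. *)
Lemma right_spine_records T : treap T ->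
  (right_spine T <= suffix_records <=%O (priorities T))%N.
Proof.
rewrite /priorities; elim: T => //= m L _ e T IH /and3P[le_e _ tT].
rewrite map_cat; apply: leq_trans (suffix_records_cat _ _ _) => /=.
move: le_e; rewrite all_cat all_map => /andP[_ ->].
by rewrite add1n ltnS IH.
Qed.

Lemma left_spine_records T : treap T ->
  (left_spine T <= suffix_records <=%O (rev (priorities T)))%N.
Proof.
rewrite /priorities; elim: T => //= m L IH e T _ /and3P[le_e tL _].
rewrite map_cat rev_cat /= rev_cons cat_rcons.
apply: leq_trans (suffix_records_cat _ _ _) => /=.
move: le_e; rewrite all_cat all_rev all_map => /andP[-> _].
by rewrite add1n ltnS IH.
Qed.

(** Each recursive call goes one step down the right spine of [T] or the left spine of [T']. *)
Lemma work_join_treap T e T' :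
  (work (join_treap T e T') <= (right_spine T + left_spine T').+1)%N.
Proof.
elim: T T' => [|m L _ e1 T IH] T'; elim: T' => [|m' L' IH' e2 T' _] //=.
- rewrite /work /=; case: ifP => //= _; rewrite addn0.
  exact: IH'.
- rewrite /work /=; case: ifP => //= _; rewrite !addn0 ltnS.
  by have := IH Leaf; rewrite addn0.
- rewrite /work /=; case: ifP => //= _; case: ifP => _ /=; rewrite addn0 ltnS.
    by rewrite addSn; apply: IH.
  by rewrite addnS; apply: IH'.
Qed.

Lemma outranksP e T : all (fun e' : entry => e'.2 <= e.2) (inorder T) ->
  outranks e T.
Proof. by case: T => //= m L e' T; rewrite all_cat /= => /and3P[]. Qed.

Lemma join_treap_root T e T' : outranks e T -> outranks e T' ->
  join_treap T e T' = (Node tt T e T', 1%N).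
Proof.
by case: T T' => [|m L f T] [|m' L' f' T'] /= h1 h2; rewrite ?h1 ?h2.
 Qed.

(** By heap order [e] outranks [L] and whatever remains of the right subtree, so the join stops at
    once. Each level costs at most two units: the [tick] of [splitLast] and that of the join. *)
Lemma splitLast_treap T m L e :
  let S := splitLast (@join_treap R K) L e T in
  treap (Node m L e T) ->
  [/\ treap (value S).1,
      inorder (Node m L e T) = rcons (inorder (value S).1) (value S).2 &
      (work S <= 2 * right_spine (Node m L e T))%N].
Proof.
elim: T m L e => [|m1 L1 _ e1 T IH] m L e S.
  by move=> /= /and3P[_ tL _]; rewrite -cats1.
rewrite [treap _]/= => /and3P[le_e tL tT].
have [tS inS wS] := IH m1 L1 e1 tT.
rewrite {}/S /=; set S := splitLast _ L1 e1 T in tS inS wS *.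
rewrite -[_ ++ _ :: _]/(inorder (Node m1 L1 e1 T)) inS in le_e *.
move: (le_e); rewrite all_cat => /andP[leL]; rewrite all_rcons => /andP[_ leS].
rewrite /value /= -/(value S) join_treap_root ?outranksP //=.
split.
- by rewrite all_cat leL leS tL.
- by rewrite rcons_cat.
- by move: wS; rewrite {2}/work /= -/(work S); lia.
Qed.

(** The three record counts pay for [splitLast] and for the two spines walked by the final join. The
    sequence without its last entry is counted separately, since dropping a high last entry may
    create records. *)
Lemma work_join2_treap T T' : treap T -> treap T' ->
  let s := priorities T in
  let recs := suffix_records <=%O in
  (work (join2 (@join_treap R K) T T') <=
    2 + 2 * recs s + recs (take (size s).-1 s)
    + recs (rev (priorities T')))%N.
Proof.
case: T => [|m L e T] tT tT' //=.
have [tS inS wS] := splitLast_treap tT.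
have := right_spine_records tT; have := right_spine_records tS.
have := left_spine_records tT'.
set S := splitLast _ _ _ _ in tS inS wS *.
have wJ := work_join_treap (value S).1 (value S).2 T'.
rewrite /work /= -/(work S) -/(work (join_treap _ _ _)).
rewrite /priorities inS map_rcons size_rcons /= -cats1 take_size_cat //.
move=> h1 h2 h3; move: wS wJ => /=.
by move: h3 => /=; lia.
Qed.

End TreapWork.

(** * Counting words with many records *)

Section RecordCounting.
Local Open Scope nat_scope.
Variable Q : nat.

Definition ord_records (s : seq 'I_Q) := suffix_records (fun i j : 'I_Q => i <= j) s.

Definition record_sum (n x : nat) : nat :=
  \sum_(t : n.-tuple 'I_Q | all (fun i : 'I_Q => i < x) t) 2 ^ ord_records t.

Lemma record_sum0 x : record_sum 0 x = 1.
Proof.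
rewrite /record_sum (eq_bigl (pred1 [tuple])) ?big_pred1_eq // => t.
by rewrite tuple0 /= eqxx.
Qed.

Lemma big_cons_tuple (T : finType) n (P : pred (seq T)) (F : seq T -> nat) :
  \sum_(t : n.+1.-tuple T | P t) F t =
  \sum_(v : T) \sum_(t : n.-tuple T | P (v :: t)) F (v :: t).
Proof.
rewrite pair_big_dep /=.
rewrite (reindex (fun p : T * n.-tuple T => [tuple of p.1 :: p.2])) //=.
exists (fun t : n.+1.-tuple T => (thead t, [tuple of behead t])) => [[v t] _|t _] /=.
  by rewrite theadE; congr pair; apply: val_inj.
by rewrite [RHS]tuple_eta; apply: val_inj.
Qed.

(* Split off the head v: it is a record exactly when the tail is a word over the
   v + 1 smallest letters. *)
Lemma record_sumS n x : x <= Q ->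
  record_sum n.+1 x = x * record_sum n x + \sum_(v < x) record_sum n v.+1.
Proof.
move=> xQ.
rewrite /record_sum (big_cons_tuple _ (fun s => all (fun i : 'I_Q => i < x) s)
  (fun s => 2 ^ ord_records s)).
transitivity (\sum_(v : 'I_Q | v < x) (record_sum n x + record_sum n v.+1)).
  rewrite [RHS]big_mkcond /=; apply: eq_bigr => v _.
  case: ifP => vx; last by rewrite big_pred0.
  rewrite /record_sum /= [X in _ + X](_ : _ = \sum_(t : n.-tuple 'I_Q |
      all (fun i : 'I_Q => i < x) t && all (fun i : 'I_Q => i <= v) t)
      2 ^ ord_records t); last first.
    apply: eq_bigl => t; rewrite andb_idl // => /allP h; apply/allP => i /h.
    by move=> iv; apply: leq_ltn_trans iv vx.
  (* A record at the head doubles the summand; the second copy is the one collected by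
     [record_sum n v.+1]. *)
  rewrite big_mkcondr -big_split /=; apply: eq_bigr => t _.
  rewrite /ord_records /= expnD.
  by case: (all _ _); rewrite /= ?addn0 ?mul1n // expn1 mul2n addnn.
rewrite (big_ord_narrow xQ) big_split /= sum_nat_const card_ord.
by rewrite mulnC.
Qed.

(** These are the two leading terms of the binomial expansion. *)
Lemma leq_mul_exp a n : n.+1 * a ^ n + a ^ n.+1 <= a.+1 ^ n.+1.
Proof.
elim: n => [|n IH]; first by rewrite !expn1 expn0; lia.
rewrite [a.+1 ^ _]expnS [a.+1 * _]mulSn [n.+2 * _]mulSn.
set y := a.+1 ^ n.+1 in IH *.
have : a * (n.+1 * a ^ n + a ^ n.+1) <= a * y by rewrite leq_mul2l IH orbT.
rewrite mulnDr mulnCA -!expnS; lia.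
Qed.

(** A discrete form of integrating [n.+1 * y ^ n], telescoped by [leq_mul_exp]. *)
Lemma sum_exp_leq a x n : \sum_(v < x) n.+1 * (v.+1 + a) ^ n <= (x.+1 + a) ^ n.+1.
Proof.
elim: x => [|x IH]; first by rewrite big_ord0.
rewrite big_ord_recr /=; apply: leq_trans (leq_mul_exp _ _).
by rewrite addnC leq_add2l.
Qed.

Lemma record_sum_leq n x : x <= Q -> record_sum n x <= n.+1 * (x + n) ^ n.
Proof.
elim: n x => [|n IH] x xQ; first by rewrite record_sum0.
(* Of the [n.+2] copies of the power, the sum over [v] uses one and [x * record_sum n x] the other
   [n.+1]. *)
rewrite record_sumS // mulSn addnC.
apply: leq_add.
  apply: leq_trans (_ : \sum_(v < x) n.+1 * (v.+1 + n) ^ n <= _).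
    by apply: leq_sum => v _; apply: IH; apply: leq_trans xQ.
  by rewrite addnS; apply: leq_trans (sum_exp_leq _ _ _) _; rewrite addSn.
apply: leq_trans (_ : x * (n.+1 * (x + n) ^ n) <= _).
  by rewrite leq_mul2l IH ?orbT.
rewrite mulnCA leq_mul2l /= expnS; apply: leq_mul; first by lia.
by case: (n) => // p; rewrite leq_exp2r //; lia.
Qed.

(** Bernoulli's inequality for (1 - b/a)^n, multiplied by a^(n+1) to remain in the natural
    numbers. *)
Lemma Bernoulli_leq a b n : n * b <= a -> a ^ n * (a - n * b) <= a * (a - b) ^ n.
Proof.
elim: n => [|n IH] nb; first by rewrite !expn0 mul0n subn0 mul1n muln1.
have {}IH := IH ltac:(lia).
rewrite !expnS.
have h : a * (a - n.+1 * b) <= (a - b) * (a - n * b) by nia.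
have : (a ^ n * (a * (a - n.+1 * b)) <= a ^ n * ((a - b) * (a - n * b))).
  by rewrite leq_mul2l h orbT.
have : (a - b) * (a ^ n * (a - n * b)) <= (a - b) * (a * (a - b) ^ n).
  by rewrite leq_mul2l IH orbT.
nia.
Qed.

Lemma exp_shift_leq n : 0 < n -> 2 * n ^ 2 <= Q -> (Q + n) ^ n <= 2 * Q ^ n.
Proof.
move=> n0 hQ.
have := @Bernoulli_leq (Q + n) n n; rewrite addnK => /(_ ltac:(nia)).
have h : Q + n <= 2 * (Q + n - n * n) by nia.
move=> h1; have {}h1 : 2 * ((Q + n) ^ n * (Q + n - n * n)) <= 2 * ((Q + n) * Q ^ n).
  by rewrite leq_mul2l.
have : (Q + n) ^ n * (Q + n) <= (Q + n) ^ n * (2 * (Q + n - n * n)).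
  by rewrite leq_mul2l h orbT.
rewrite mulnCA => /leq_trans /(_ h1).
by rewrite mulnCA mulnC leq_pmul2l // addn_gt0 n0 orbT.
Qed.

Lemma card_many_records n k : 2 * n ^ 2 <= Q ->
  2 ^ k * #|[set t : n.-tuple 'I_Q | k <= ord_records t]| <= 2 * n.+1 * Q ^ n.
Proof.
move=> hQ; apply: leq_trans (_ : record_sum n Q <= _).
  rewrite mulnC -sum_nat_const /record_sum.
  rewrite [leqRHS](eq_bigl predT) => [|t]; last by apply/allP => i _; apply: ltn_ord.
  rewrite [leqLHS]big_mkcond; apply: leq_sum => t _; rewrite inE.
  by case: ifP => // kt; rewrite leq_exp2l.
apply: leq_trans (record_sum_leq _ (leqnn _)) _.
rewrite -mulnA mulnCA leq_mul2l /=; case: n hQ => [|n] hQ; first by rewrite !expn0.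
exact: exp_shift_leq.
Qed.

End RecordCounting.

(** * Records of independent uniform priorities *)

Section RecordsWHP.
Local Open Scope classical_set_scope.
Context (d : measure_display) (Omega : measurableType d) (R : realType).
Variable P : probability Omega R.

Definition cell Q (v : 'I_Q) : set R := `[v%:R / Q%:R, v.+1%:R / Q%:R[.

Lemma measurable_cell Q (v : 'I_Q) : measurable (cell v).
Proof. exact: measurable_itv. Qed.

(** The right end of a cell is excluded, hence v < w + 1. With [x = y] this also gives disjointness
    of the cells. *)
Lemma cell_le Q (v w : 'I_Q) (x y : R) :
  cell v x -> cell w y -> x <= y -> (v <= w)%N.
Proof.
have Q0 : 0 < Q%:R :> R by rewrite ltr0n; apply: leq_ltn_trans (ltn_ord v).
rewrite /cell /= !in_itv /= => /andP[vx _] /andP[_ yw] xy.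
have : v%:R / Q%:R < w.+1%:R / Q%:R :> R.
  by apply: le_lt_trans vx _; apply: le_lt_trans yw.
by rewrite ltr_pM2r ?invr_gt0 // ltr_nat.
Qed.

Lemma prob_cell Q (v : 'I_Q) (X : {RV P >-> R}) : uniform01 X ->
  P (X @^-1` cell v) = (Q%:R^-1)%:E.
Proof.
move=> /(_ _ (measurable_cell v)); rewrite /distribution /pushforward => ->.
have Q0 : 0 < Q%:R :> R by rewrite ltr0n; apply: leq_ltn_trans (ltn_ord v).
rewrite /uniform_prob.
rewrite (eq_integral (cst 1%E)) => [|x]; last first.
  rewrite inE /cell /= in_itv /= => /andP[vx xv].
  rewrite /uniform_pdf (_ : 0 <= x <= 1) ?subr0 ?invr1 //; apply/andP; split.
    by apply: le_trans vx; rewrite divr_ge0.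
  apply: ltW; apply: lt_le_trans xv _.
  by rewrite ler_pdivrMr // mul1r ler_nat.
rewrite integral_cst; last exact: measurable_cell.
rewrite mul1e [LHS](lebesgue_measure_itv `[v%:R / Q%:R, v.+1%:R / Q%:R[%R) /=.
rewrite lte_fin ltr_pM2r ?invr_gt0 //.
by rewrite ltr_nat leqnn -EFinB -mulrBl -natrB // subSnn mul1r.
Qed.

Context (I : finType) (X : I -> {RV P >-> R}).
Hypothesis indep : independent_RVs X.
Hypothesis unif : forall i, uniform01 (X i).

(** The word [t] spells the cells of the priorities listed in [s]. The intersection ranges over a
    set of indices to match [independent_RVs]. *)
Definition box Q (s : seq I) (t : seq 'I_Q.+1) : set Omega :=
  \bigcap_(i in [set` [set j in s]%SET])
    (X i @^-1` cell (nth ord0 t (index i s))).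

Lemma measurable_box Q s (t : seq 'I_Q.+1) : measurable (box s t).
Proof.
apply: fin_bigcap_measurable => // i _.
by apply: measurable_funPTI; exact: measurable_cell.
Qed.

Lemma prob_box Q s (t : seq 'I_Q.+1) : uniq s ->
  P (box s t) = (Q.+1%:R ^- size s)%:E.
Proof.
move=> us; rewrite /box indep; last by move=> i; exact: measurable_cell.
under eq_bigr do rewrite prob_cell //.
by rewrite prodEFin prodr_const cardsE (card_uniqP us) exprVn.
Qed.

Lemma box_inj Q s (t t' : seq 'I_Q.+1) omega : uniq s ->
  size t = size s -> size t' = size s -> box s t omega -> box s t' omega ->
  t = t'.
Proof.
move=> us st st' bt bt'; apply: (@eq_from_nth _ ord0) => [|i]; first by rewrite st'.
rewrite st => is_; case: s us st st' bt bt' is_ => // i0 s us st st' bt bt' is_.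
set s' := i0 :: s in us st st' bt bt' is_ *.
have ins : nth i0 s' i \in [set j in s']%SET by rewrite inE mem_nth.
have := bt _ ins; have := bt' _ ins; rewrite index_uniq // => c' c.
apply: val_inj; apply/eqP; rewrite eqn_leq.
by rewrite (cell_le c c') ?lexx // (cell_le c' c) ?lexx.
Qed.

Lemma records_box Q s (t : seq 'I_Q.+1) omega : uniq s ->
  size t = size s -> box s t omega ->
  (suffix_records <=%O [seq X i omega | i <- s] <= ord_records t)%N.
Proof.
move=> us st bt; rewrite (_ : t = [seq nth ord0 t (index i s) | i <- s]).
  apply: suffix_records_le => i j si sj; apply: cell_le; apply: bt => /=;
  by rewrite inE.
case: s us st {bt} => [|i0 s] us st; first by rewrite (size0nil st).
apply: (@eq_from_nth _ ord0); first by rewrite size_map.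
by move=> i; rewrite st => si; rewrite (nth_map i0) // index_uniq.
Qed.

(** The event is the disjoint union of the boxes of words with fewer than [k] records. All boxes
    have equal probability, so its probability is the proportion of such words. An outcome with a
    priority outside [0,1[ lies in no box. *)
Lemma records_whp (s : seq I) (k : nat) : uniq s ->
  exists E : set Omega, [/\ measurable E,
    forall omega, E omega ->
      (suffix_records <=%O [seq X i omega | i <- s] < k)%N &
    ((1 - (2 * (size s).+1)%:R / 2 ^+ k)%:E <= P E)%E].
Proof.
(* The alphabet has [Q.+1] letters, so it is nonempty even for [n = 0]. *)
move=> us; set n := size s; set Q := (2 * n ^ 2)%N.
pose G := [set t : n.-tuple 'I_Q.+1 | (k <= ord_records t)%N]%SET.
exists (\bigcup_(t in [set` enum (~: G)]) box s t); split.
- by apply: fin_bigcup_measurable => // t _; exact: measurable_box.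
- move=> omega [t /=]; rewrite mem_enum !inE -ltnNge => tk bt.
  by apply: leq_ltn_trans tk; apply: records_box; rewrite ?size_tuple.
rewrite measure_fin_bigcup //; first last.
- by move=> t _; exact: measurable_box.
- apply/trivIsetP => t t' _ _ /eqP tt'; rewrite -subset0 => omega [bt bt'].
  by apply: tt'; apply: val_inj; apply: box_inj bt bt'; rewrite ?size_tuple.
rewrite -fsbig_seq ?enum_uniq //=.
under eq_bigr do rewrite prob_box //.
rewrite sumEFin lee_fin big_enum /= sumr_const -/n.
have cG := cardsC G; rewrite card_tuple card_ord in cG.
have := card_many_records (Q := Q.+1) (n := n) k (leqnSn _); rewrite -/G => mG.
have q0 : 0 < Q.+1%:R ^+ n :> R by rewrite exprn_gt0.
have k0 : 0 < 2 ^+ k :> R by rewrite exprn_gt0.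
rewrite -[leRHS]mulr_natr [leRHS]mulrC.
have -> : (#|~: G|)%:R = Q.+1%:R ^+ n - #|G|%:R :> R.
  by rewrite -natrX -cG natrD addrC addKr.
rewrite mulrBl mulfV ?gt_eqF // lerD2l lerN2.
rewrite ler_pdivrMr // mulrAC ler_pdivlMr //.
by rewrite -!natrX -!natrM ler_nat mulnC.
Qed.

End RecordsWHP.

(** * High-probability bound for treaps *)

Lemma probability_setI_ge (d : measure_display) (Omega : measurableType d)
    (R : realType) (P : probability Omega R) (A B : set Omega) (x y : R) :
  measurable A -> measurable B ->
  ((1 - x)%:E <= P A)%E -> ((1 - y)%:E <= P B)%E ->
  ((1 - (x + y))%:E <= P (A `&` B)%classic)%E.
Proof.
move=> mA mB.
have fA := fin_num_measure P _ mA; have fB := fin_num_measure P _ mB.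
have mAB : measurable (A `&` B)%classic by exact: measurableI.
have fAB := fin_num_measure P _ mAB.
have : (P (~` (A `&` B))%classic <= P (~` A)%classic + P (~` B)%classic)%E.
  by rewrite setCI; apply: measureU2; exact: measurableC.
rewrite !probability_setC //.
rewrite -(fineK fA) -(fineK fB) -(fineK fAB) -!EFinB -EFinD !lee_fin.
by lra.
Qed.

Section TreapJoin2.
Context (R : realType) (K : Type).

(** Here 2^k >= N^(b+5), where b = [Num.bound c] exceeds [c]. The factor N^5 covers the numerators:
    6(N+1) <= 16 N <= N^5 for N >= 2. *)
Lemma three_records_bound (c : R) (N a1 a2 a3 k : nat) : (1 < N)%N ->
  (a1 <= N)%N -> (a2 <= N)%N -> (a3 <= N)%N ->
  ((Num.bound c + 5) * up_log 2 N <= k)%N -> 0 < c ->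
  (2 * a1.+1)%:R / 2 ^+ k + (2 * a2.+1)%:R / 2 ^+ k + (2 * a3.+1)%:R / 2 ^+ k
    <= N%:R `^ (- c) :> R.
Proof.
move=> N1 h1 h2 h3 hk c0.
have N1R : 1 <= N%:R :> R by rewrite ler1n ltnW.
have k0 : 0 < 2 ^+ k :> R by rewrite exprn_gt0.
apply: le_trans (_ : N%:R `^ (- (Num.bound c)%:R) <= _); last first.
  by apply: ler_powR => //; rewrite lerN2 ltW // archi_boundP // ltW.
rewrite powR_invn ?ler0n // -!mulrDl ler_pdivrMr // mulrC ler_pdivlMr; last first.
  by rewrite exprn_gt0 // ltr0n ltnW.
rewrite -!natrD -!natrX -natrM ler_nat.
set b := Num.bound c in hk *.
apply: leq_trans (_ : N ^ (b + 5) <= _)%N; last first.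
  apply: leq_trans (_ : (2 ^ up_log 2 N) ^ (b + 5) <= _)%N.
    by rewrite leq_exp2r ?addn_gt0 ?orbT //; exact: up_logP.
  by rewrite -expnM leq_exp2l // mulnC.
rewrite expnD mulnC leq_mul2l; apply/orP; right.
have : (2 ^ 4 <= N ^ 4)%N by rewrite leq_exp2r.
by rewrite [(N ^ 5)%N]expnS => h; nia.
Qed.

(** From m + n <= (m+1)(n+1) the logarithm is at most the sum of the ranks plus 2; the factor 3
    absorbs the 2. *)
Lemma up_log_rank (m n : nat) (T T' : tree unit (K * R)) :
  size_tree T = m -> size_tree T' = n -> (0 < m)%N ->
  (up_log 2 (m + n))%:Z <= 3 * Num.max 1 (rank_weight T + rank_weight T').
Proof.
move=> sT sT' m0; rewrite /rank_weight /weight sT sT'.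
have : (up_log 2 (m + n) <= up_log 2 m.+1 + up_log 2 n.+1)%N.
  apply: up_log_min => //; rewrite expnD.
  apply: leq_trans (_ : m.+1 * n.+1 <= _)%N; first by nia.
  by apply: leq_mul; exact: up_logP.
by lia.
Qed.

Lemma treap_join2_work (c : R) : 0 < c -> exists C : nat,
  forall (d : measure_display) (Omega : measurableType d)
    (P : probability Omega R) (m n : nat)
    (key : 'I_(m + n) -> K) (prio : 'I_(m + n) -> {RV P >-> R}),
  independent_RVs prio -> (forall i, uniform01 (prio i)) ->
  with_prob_at_least P (m + n) c (fun omega : Omega =>
    forall Tl Tr : tree unit (K * R), treap Tl -> treap Tr ->
    inorder Tl =
      [seq (key (lshift n i), prio (lshift n i) omega) | i <- enum 'I_m] ->
    inorder Tr =
      [seq (key (rshift m j), prio (rshift m j) omega) | j <- enum 'I_n] ->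
    (work (join2 (@join_treap R K) Tl Tr))%:Z
      <= C%:Z * Num.max 1 (rank_weight Tl + rank_weight Tr)).
Proof.
move=> c0; set b := (Num.bound c + 5)%N.
(* The work is at most [2 + 4 * k], where 4 = 2 + 1 + 1 counts the record terms, and [k] is at most
   3b times the target by [up_log_rank]. *)
exists (2 + 12 * b)%N => d Omega P m n key prio indep unif.
(* If [m = 0], then [Tl] is a leaf and [join2] does one unit of work in every outcome. *)
have [m0|m0] := posnP m.
  exists setT; split; first exact: measurableT.
    move=> omega _ [|? ? ? ?] Tr _ _ + _; last first.
      by move=> /(congr1 size); rewrite size_map size_enum_ord m0 size_cat addnS.
    move=> _; rewrite /work /=.
    apply: le_trans (_ : 1 * Num.max 1 (rank_weight Leaf + rank_weight Tr) <= _).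
      by lia.
    by apply: ler_wpM2r; lia.
  by rewrite probability_setT lee_fin gerBl powR_ge0.
(* For a single entry the required probability is 1 - 1^(-c) = 0, so the empty event suffices. *)
have [N1|N1] := leqP (m + n) 1.
  exists set0; split; [exact: measurable0|by []|].
  have -> : (m + n = 1)%N by lia.
  by rewrite measure0 powR1 subrr.
pose k := (b * up_log 2 (m + n))%N.
pose s := [seq lshift n i | i <- enum 'I_m].
pose s' := [seq rshift m i | i <- enum 'I_n].
have us : uniq s by rewrite map_inj_uniq ?enum_uniq //; exact: lshift_inj.
have us' : uniq s' by rewrite map_inj_uniq ?enum_uniq //; exact: rshift_inj.
have size_s : size s = m by rewrite size_map size_enum_ord.
have size_s' : size s' = n by rewrite size_map size_enum_ord.
have [E1 [mE1 E1s P1]] := records_whp indep unif k us.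
have [E2 [mE2 E2s P2]] := records_whp indep unif k (take_uniq m.-1 us).
have urs' : uniq (rev s') by rewrite rev_uniq.
have [E3 [mE3 E3s P3]] := records_whp indep unif k urs'.
have mE12 := measurableI _ _ mE1 mE2.
exists (E1 `&` E2 `&` E3)%classic; split; first exact: measurableI.
  move=> omega [[/E1s r1 /E2s r2] /E3s r3] Tl Tr tTl tTr inTl inTr.
  have pTl : priorities Tl = [seq prio i omega | i <- s].
    by rewrite /priorities inTl -!map_comp.
  have pTr : priorities Tr = [seq prio i omega | i <- s'].
    by rewrite /priorities inTr -!map_comp.
  have := work_join2_treap tTl tTr.
  rewrite /= pTl pTr size_map size_s -map_take -map_rev => w.
  have sTl : size_tree Tl = m.
    by rewrite -size_inorder inTl size_map size_enum_ord.
  have sTr : size_tree Tr = n.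
    by rewrite -size_inorder inTr size_map size_enum_ord.
  have := up_log_rank sTl sTr m0.
  set x := Num.max _ _ => ux.
  have x1 : 1 <= x by rewrite /x; lia.
  have : (work (join2 (@join_treap R K) Tl Tr) <= 2 + 4 * k)%N.
    apply: leq_trans w _; move: r1 r2 r3.
    set a1 := suffix_records _ _; set a2 := suffix_records _ _.
    by set a3 := suffix_records _ _; lia.
  rewrite /k; move: (up_log _ _) ux => u ux wk.
  have : b%:Z * u%:Z <= b%:Z * (3 * x) by apply: ler_wpM2l.
  have : (work (join2 (@join_treap R K) Tl Tr))%:Z <= 2 + 4 * (b%:Z * u%:Z).
    by lia.
  move=> h1 h2; apply: le_trans h1 _.
  rewrite (_ : _ * x = 2 * x + 4 * (b%:Z * (3 * x))); last first.
    by rewrite PoszD PoszM; ring.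
  by lia.
apply: le_trans (probability_setI_ge mE12 mE3
  (probability_setI_ge mE1 mE2 P1 P2) P3).
rewrite lee_fin lerD2l lerN2.
apply: three_records_bound => //.
- by rewrite size_s leq_addr.
- by rewrite size_take size_s; case: ifP => _; lia.
- by rewrite size_rev size_s' leq_addl.
Qed.

End TreapJoin2.

Theorem theorem3 (R : realType) (K : Type) :
  [/\ (forall join, join_spec (@avl K) (@rank_avl K) join ->
         join2_work_bound (@avl K) (@rank_avl K) join),
      (forall join, join_spec (@red_black K) (@rank_rb K) join ->
         join2_work_bound (@red_black K) (@rank_rb K) join),
      (forall alpha : R, 2 / 11 < alpha -> alpha <= 1 - (Num.sqrt 2)^-1 ->
       forall join,
         join_spec (@weight_balanced R K alpha) (@rank_weight unit K) join ->
         join2_work_bound (@weight_balanced R K alpha) (@rank_weight unit K)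
           join) &
      (* [key i] and [prio i] are the key and the priority of the i-th entry in
         in-order; the first [m] entries form [Tl], the other [n] form [Tr]. *)
      forall c : R, 0 < c -> exists C : nat,
        forall (d : measure_display) (Omega : measurableType d)
          (P : probability Omega R) (m n : nat)
          (key : 'I_(m + n) -> K) (prio : 'I_(m + n) -> {RV P >-> R}),
        independent_RVs prio -> (forall i, uniform01 (prio i)) ->
        with_prob_at_least P (m + n) c (fun omega : Omega =>
          forall Tl Tr : tree unit (K * R), treap Tl -> treap Tr ->
          inorder Tl =
            [seq (key (lshift n i), prio (lshift n i) omega)
               | i <- enum 'I_m] ->
          inorder Tr =
            [seq (key (rshift m j), prio (rshift m j) omega)
               | j <- enum 'I_n] ->
          (work (join2 (@join_treap R K) Tl Tr))%:Z
            <= C%:Z * Num.max 1 (rank_weight Tl + rank_weight Tr))].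
Proof.
split.
- exact: avl_join2_work.
- exact: rb_join2_work.
- by move=> alpha alpha_gt _; exact: wb_join2_work.
- exact: treap_join2_work.
Qed.
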